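(* Let $\Lambda$ be a totally ordered nontrivial abelian group and let $G$ be a group acting by isometries on a $\Lambda$-tree $(X,d)$ with the translation length function $\lVert\cdot\rVert\colon G\to\Lambda_{+}$. If $(a,b)\in G\times G$ is a ping-pong pair with respect to $\lVert\cdot\rVert$, then the subgroup $\langle a,b\rangle$ is free of rank two and acts freely, without inversions, and properly discontinuously on $(X,d)$. Moreover, if $G$ is a topological group and $\lVert\cdot\rVert$ is continuous at the identity, then $\langle a,b\rangle$ is discrete with respect to the topology inherited from $G$.
   Context: $\Lambda$ is written additively; $\Lambda_{+}:=\{\lambda\in\Lambda:\lambda\ge 0\}$ and $|\lambda|:=\max\{\lambda,-\lambda\}$. A $\Lambda$-metric space $(X,d)$ is defined by the usual axioms of a metric space, except that $d$ takes values in $\Lambda$; it carries the topology with the family of open balls as a basis. $\Lambda$ itself is a $\Lambda$-metric space with $d(x,y)=|x-y|$, and is given the corresponding topology. Isometries are surjective distance-preserving maps; an isometric embedding is a distance-preserving map that need not be surjective. A segment in $(X,d)$ is the image of an isometric embedding $i\colon[p,q]_\Lambda\to X$ of a closed interval $[p,q]_\Lambda=\{x\in\Lambda: p\le x\le q\}$, $p\le q$ in $\Lambda$; $i(p),i(q)$ are its endpoints. $(X,d)$ is geodesic if any two points are the endpoints of some segment. A $\Lambda$-tree is a geodesic $\Lambda$-metric space such that: (i) if two segments intersect in a single point which is an endpoint of both, then their union is a segment; (ii) the intersection of two segments with a common endpoint is a segment. An isometry $g$ of a $\Lambda$-tree is an inversion if $g$ has no fixed point in $X$ but $g^2$ does.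 The translation length of $g$ is $\lVert g\rVert:=0$ if $g$ is an inversion, and $\lVert g\rVert:=\min\{d(x,gx):x\in X\}$ otherwise (the minimum exists). For an action of $G$ by isometries, the translation length function assigns to $g\in G$ the translation length of the isometry by which $g$ acts. $(g,h)\in G\times G$ is a ping-pong pair (with respect to $\lVert\cdot\rVert$) if $\lVert g\rVert>0$, $\lVert h\rVert>0$, and $\bigl|\lVert g\rVert-\lVert h\rVert\bigr|<\min\{\lVert gh\rVert,\lVert gh^{-1}\rVert\}$. An action of a group on a set is free if every point has trivial stabilizer; an action on a topological space $X$ is properly discontinuous if every $x\in X$ has a neighborhood $U$ such that $gU\cap U\ne\emptyset$ implies $g=1$. An action is without inversions if no group element acts as an inversion. *)

(* Defs.v *)
From HB Require Import structures.
From mathcomp Require Import all_boot all_order all_algebra.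
From mathcomp Require Import boolp classical_sets topology.

Set Implicit Arguments.
Unset Strict Implicit.
Unset Printing Implicit Defensive.

Import Order.TTheory GRing.Theory.

Local Open Scope classical_set_scope.
Local Open Scope ring_scope.

(* porderZmodType is a partial order and an abelian group on the same carrier,
   with no compatibility between the two. *)
Definition totally_ordered_group (L : porderZmodType) : Prop :=
  total (<=%R : rel L) /\ (forall x y z : L, x <= y -> x + z <= y + z).

HB.mixin Record Group_isTopologicalGroup G
    of Group G & Topological G := {
  mulg_continuous : continuous (fun x : G * G => (x.1 * x.2)%g);
  invg_continuous : continuous (fun x : G => (x^-1)%g)
}.

(* No separation axiom is imposed. *)
#[short(type="topologicalGroupType")]
HB.structure Definition TopologicalGroup :=
  { G of Group G & Topological G & Group_isTopologicalGroup G }.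

Section LambdaMetric.
Context {L : porderZmodType}.

Definition absL (x : L) : L := Order.max x (- x).

Definition distL (x y : L) : L := absL (x - y).

Section Space.
Context {X : Type} (d : X -> X -> L).

Definition lambda_metric : Prop :=
  [/\ forall x y, 0 <= d x y,
      forall x y, d x y = 0 <-> x = y,
      forall x y, d x y = d y x
    & forall x y z, d x z <= d x y + d y z].

Definition lambda_ball (x : X) (r : L) : set X := [set y | d x y < r].

Definition lambda_open (U : set X) : Prop :=
  exists2 D : set (X * L), (forall p, D p -> 0 < p.2)
    & U = \bigcup_(p in D) lambda_ball p.1 p.2.

Definition lambda_nbhs (x : X) (U : set X) : Prop :=
  exists V : set X, [/\ lambda_open V, V x & V `<=` U].

(* i is a total function, but only its restriction to [p, q] matters. *)
Definition segment_from_to (x y : X) (S : set X) : Prop :=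
  exists (p q : L) (i : L -> X),
    [/\ p <= q,
        forall s t : L, p <= s <= q -> p <= t <= q -> d (i s) (i t) = distL s t,
        i p = x, i q = y & S = i @` [set t | p <= t <= q]].

Definition segment (S : set X) : Prop := exists x y, segment_from_to x y S.

Definition endpoint (S : set X) (x : X) : Prop :=
  exists y, segment_from_to x y S \/ segment_from_to y x S.

Definition geodesic : Prop := forall x y, exists S, segment_from_to x y S.

Definition lambda_tree : Prop :=
  [/\ lambda_metric,
      geodesic,
      forall S T x, segment S -> segment T -> endpoint S x -> endpoint T x ->
        S `&` T = [set x] -> segment (S `|` T)
    & forall S T x, segment S -> segment T -> endpoint S x -> endpoint T x ->
        segment (S `&` T)].

Definition isometry (f : X -> X) : Prop :=
  (forall x y, d (f x) (f y) = d x y) /\ (forall y, exists x, f x = y).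

Definition inversion (f : X -> X) : Prop :=
  (forall x, f x <> x) /\ (exists x, f (f x) = x).

(* The least element of the set of displacements; the default value 0 of xget
   is only reached when there is none, which does not happen for an isometry
   of a nonempty Lambda-tree that is not an inversion. *)
Definition translation_length (f : X -> X) : L :=
  if `[< inversion f >] then 0
  else let D := range (fun x => d x (f x)) in xget 0 (D `&` lbound D).

End Space.

Section Action.
Context {X : Type} (d : X -> X -> L) {G : groupType} (act : G -> X -> X).

Definition isometric_action : Prop :=
  [/\ forall x, act 1%g x = x,
      forall g h x, act (g * h)%g x = act g (act h x)
    & forall g, isometry d (act g)].

Definition translation_length_function (g : G) : L :=
  translation_length d (act g).

Definition acts_freely (H : set G) : Prop :=
  forall x g, H g -> act g x = x -> g = 1%g.

Definition acts_without_inversions (H : set G) : Prop :=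
  forall g, H g -> ~ inversion (act g).

Definition acts_properly_discontinuously (H : set G) : Prop :=
  forall x, exists2 U, lambda_nbhs d x U
    & forall g, H g -> (act g @` U) `&` U !=set0 -> g = 1%g.

End Action.

Definition ping_pong_pair {G : groupType} (ell : G -> L) (g h : G) : Prop :=
  [/\ 0 < ell g, 0 < ell h
    & absL (ell g - ell h) < Order.min (ell (g * h)%g) (ell (g * h^-1)%g)].

Definition continuous_at_one {G : topologicalGroupType} (ell : G -> L) : Prop :=
  forall U, lambda_nbhs distL (ell 1%g) U -> nbhs (1%g : G) (ell @^-1` U).

End LambdaMetric.

Definition generated_by_pair {G : groupType} (a b : G) : set G :=
  smallest [set S : set G | group_closed [in S]] [set a; b].

(* Universal property of the free group on the two letters x, y, for a subgroup
   H of G: homomorphisms from H to K are the functions G -> K that are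
   multiplicative on H, up to equality on H. *)
Definition free_basis2 {G : groupType} (H : set G) (x y : G) : Prop :=
  [/\ H x, H y
    & forall (K : groupType) (k l : K),
        let extends (f : G -> K) :=
          [/\ {in H &, {morph f : u v / (u * v)%g}}, f x = k & f y = l] in
        exists2 f, extends f & forall f', extends f' -> {in H, f' =1 f}].

Definition free_of_rank_two {G : groupType} (H : set G) : Prop :=
  exists x y, free_basis2 H x y.

Definition discrete_subspace {T : topologicalType} (H : set T) : Prop :=
  forall A : set T, A `<=` H -> exists2 U, open U & A = H `&` U.

(* Main.v *)
(* Idea. A Lambda-tree has medians and satisfies the four-point condition, and an
   isometry with positive translation length l has an axis: the points o with
   d(o, go) = l and d(o, g^2 o) = 2 l. Let p be the point of the axis of a that is
   closest to the axis of b. The ping-pong condition says exactly that the axes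
   overlap along less than min(l(a), l(b)) if they meet. Hence at p the Gromov
   products of the four neighbours ap, a^-1 p, bp, b^-1 p are so small that the
   path p, s1 p, s1 s2 p, ... of a reduced word backtracks by less than a full edge
   at each step, and distances along it add up. For a cyclically reduced word w
   this bounds d(p, w^2 p) - d(p, w p) below by a uniform positive amount, and this
   difference is then the translation length of w. Every word which is not
   trivial in the free group is conjugate to such a w; freeness of the group and of
   the action, proper discontinuity and discreteness all follow from this bound. *)

Require Import Defs.
From mathcomp Require Import all_boot all_order all_algebra.
From mathcomp Require Import boolp classical_sets topology.

Set Implicit Arguments.
Unset Strict Implicit.
Unset Printing Implicit Defensive.

Import Order.TTheory GRing.Theory.

Local Open Scope classical_set_scope.
Local Open Scope ring_scope.

(** * Linear arithmetic in ordered abelian groups *)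

Section OrderedGroup.
Context {L : porderZmodType}.
Hypothesis L_ordered : totally_ordered_group L.
Implicit Types (x y z : L) (env : seq L) (c e : seq int).

Lemma og_leNgt x y : (x <= y) = ~~ (y < x).
Proof.
have [tot _] := L_ordered.
apply/idP/idP => [xy|]; first by apply/negP => yx; have:= lt_le_trans yx xy; rewrite ltxx.
by move: (tot x y) => /orP[//|]; rewrite le_eqVlt => /orP[/eqP->//|->].
Qed.

Lemma og_total x y : x <= y \/ y <= x.
Proof. by have [tot _] := L_ordered; apply/orP/tot. Qed.

Lemma og_subr_ge0 x y : x <= y -> 0 <= y - x.
Proof. by have [_ mono] := L_ordered; move=> /(mono _ _ (- x)); rewrite subrr. Qed.

Lemma og_subr_gt0 x y : x < y -> 0 < y - x.
Proof.
move=> xy; rewrite lt_def og_subr_ge0 ?ltW // andbT subr_eq0.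
by rewrite eq_sym; apply: contraTneq xy => ->; rewrite ltxx.
Qed.

Lemma og_addr_ge0 x y : 0 <= x -> 0 <= y -> 0 <= x + y.
Proof.
have [_ mono] := L_ordered; move=> x0 /(mono _ _ x); rewrite add0r addrC.
exact: le_trans.
Qed.

Lemma og_addr_gt0 x y : 0 < x -> 0 <= y -> 0 < x + y.
Proof.
have [_ mono] := L_ordered; move=> x0 /(mono _ _ x); rewrite add0r addrC.
exact: lt_le_trans.
Qed.

Lemma og_mulrn_ge0 x n : 0 <= x -> 0 <= x *+ n.
Proof. by move=> x0; elim: n => // n IH; rewrite mulrS og_addr_ge0. Qed.

Lemma og_mulrn_gt0 x n : 0 < x -> 0 < x *+ n.+1.
Proof. by move=> x0; rewrite mulrS og_addr_gt0 ?og_mulrn_ge0 ?ltW. Qed.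

(** * Linear forms with integer coefficients, and elimination *)

Fixpoint lin env c : L :=
  if c is n :: c' then head 0 env *~ n + lin (behead env) c' else 0.

Fixpoint addl c e : seq int :=
  match c, e with
  | n :: c', m :: e' => n + m :: addl c' e'
  | [::], _ => e
  | _, [::] => c
  end.

Definition scalel (n : int) c := [seq n * m | m <- c].

Lemma lin_addl env c e : lin env (addl c e) = lin env c + lin env e.
Proof.
elim: c e env => [|n c IH] [|m e] env /=; rewrite ?add0r ?addr0 //.
by rewrite IH mulrzDr addrACA.
Qed.

Lemma lin_scalel env n c : lin env (scalel n c) = lin env c *~ n.
Proof.
elim: c env => [|m c IH] env /=; first by rewrite mul0rz.
by rewrite IH mulrzDl mulrC mulrzA.
Qed.

Lemma lin0 env c : all (pred1 0) c -> lin env c = 0.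
Proof. by elim: c env => //= n c IH env /andP[/eqP-> /IH->]; rewrite mulr0z addr0. Qed.

Inductive lterm :=
  | LVar of nat | LZero | LAdd of lterm & lterm | LOpp of lterm | LMuln of lterm & nat.

Fixpoint leval env t : L :=
  match t with
  | LVar i => nth 0 env i
  | LZero => 0
  | LAdd t u => leval env t + leval env u
  | LOpp t => - leval env t
  | LMuln t n => leval env t *+ n
  end.

Fixpoint lnorm t : seq int :=
  match t with
  | LVar i => rcons (nseq i 0) 1
  | LZero => [::]
  | LAdd t u => addl (lnorm t) (lnorm u)
  | LOpp t => scalel (-1) (lnorm t)
  | LMuln t n => scalel n%:Z (lnorm t)
  end.

Lemma lin_lnorm env t : lin env (lnorm t) = leval env t.
Proof.
elim: t => [i||t IHt u IHu|t IH|t IH n] //=.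
- by elim: i env => [|i IH] [|x env] //=; rewrite ?mulr0z ?add0r ?addr0 // IH nth_nil.
- by rewrite lin_addl IHt IHu.
- by rewrite lin_scalel IH mulrNz.
- by rewrite lin_scalel IH.
Qed.

(* [(b, c)] stands for [0 < c] if [b], and for [0 <= c] otherwise. *)
Definition iholds env (p : bool * seq int) :=
  if p.1 then 0 < lin env p.2 else 0 <= lin env p.2.

Lemma iholds_scale env b n c : (0 < n)%N -> iholds env (b, c) -> iholds env (b, scalel n%:Z c).
Proof.
case: n => // n _; rewrite /iholds; case: b => /=; rewrite lin_scalel.
- exact: og_mulrn_gt0.
- exact: og_mulrn_ge0.
Qed.

Lemma iholds_add env b b' c e : iholds env (b, c) -> iholds env (b', e) ->
  iholds env (b || b', addl c e).
Proof.
rewrite /iholds; case: b b' => [] [] /=; rewrite lin_addl => c0 e0.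
- by rewrite og_addr_gt0 ?ltW.
- exact: og_addr_gt0.
- by rewrite addrC og_addr_gt0.
- exact: og_addr_ge0.
Qed.

(** The coefficients of index [i] cancel, and [c] itself is multiplied only by [|a|]. For nonzero
    [a] this preserves strict and weak inequalities without any division. *)
Definition elim_with e i c : seq int :=
  let a := e`_i in addl (scalel `|a|%N%:Z c) (scalel (- (sgz a * c`_i)) e).

Lemma lin_elim_with env e i c :
  lin env e = 0 -> lin env (elim_with e i c) = lin env (scalel `|(e`_i)%R|%N%:Z c).
Proof. by move=> e0; rewrite lin_addl [X in _ + X]lin_scalel e0 mul0rz addr0. Qed.

Fixpoint elim_eqs (fuel : nat) (es : seq (seq int)) (cs : seq (bool * seq int)) :=
  match fuel, es with
  | S fuel, e :: es =>
    let i := find (fun a => a != 0) e in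
    (* On a zero vector [find] runs past the end, where the default coefficient is 0, so [e] is
       dropped. *)
    if e`_i == 0 then elim_eqs fuel es cs else
    elim_eqs fuel [seq elim_with e i c | c <- es]
      [seq (p.1, elim_with e i p.2) | p <- cs]
  | _, _ => cs
  end.

Lemma elim_eqsP env fuel es cs :
  (forall e, e \in es -> lin env e = 0) -> (forall p, p \in cs -> iholds env p) ->
  forall p, p \in elim_eqs fuel es cs -> iholds env p.
Proof.
elim: fuel es cs => //= fuel IH [//|e es] cs es0 cs0.
have e0 : lin env e = 0 by apply: es0; rewrite mem_head.
case: eqP => [_|/eqP ei].
  by apply: IH => // e' ?; apply: es0; rewrite in_cons orbC; apply/orP; left.
apply: IH => [_ /mapP[c ces ->]|_ /mapP[p pcs ->]].
  by rewrite lin_elim_with // lin_scalel es0 ?mul0rz // in_cons ces orbT.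
rewrite /iholds /= lin_elim_with //.
by apply: (@iholds_scale env p.1); [rewrite absz_gt0 | case: p pcs => b c; apply: cs0].
Qed.

Definition fm_combine i (p q : bool * seq int) : bool * seq int :=
  (p.1 || q.1, addl (scalel `|(q.2`_i)%R|%N%:Z p.2) (scalel `|(p.2`_i)%R|%N%:Z q.2)).

Definition fm_pos i (cs : seq (bool * seq int)) := [seq p <- cs | (0 < p.2`_i :> int)].
Definition fm_neg i (cs : seq (bool * seq int)) := [seq p <- cs | (p.2`_i < 0 :> int)].
Definition fm_nil i (cs : seq (bool * seq int)) := [seq p <- cs | p.2`_i == 0].

Definition fm_step i cs :=
  undup (fm_nil i cs ++ [seq fm_combine i p q | p <- fm_pos i cs, q <- fm_neg i cs]).

Lemma fm_stepP env i cs : (forall p, p \in cs -> iholds env p) ->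
  forall p, p \in fm_step i cs -> iholds env p.
Proof.
move=> cs0 p; rewrite mem_undup mem_cat => /orP[|].
  by rewrite mem_filter => /andP[_ /cs0].
case/allpairsP => -[[b c] [b' e]] /= []; rewrite !mem_filter /=.
move=> /andP[ci /cs0 c0] /andP[ei /cs0 e0] ->.
apply: iholds_add; apply: iholds_scale => //; rewrite absz_gt0.
- by rewrite lt_eqF.
- by rewrite gt_eqF.
Qed.

Definition fm_cost cs i := (size (fm_pos i cs) * size (fm_neg i cs))%N.

(** Success means that 0 < 0 has been derived. Each round eliminates the variable with the fewest
    pairs to combine, which restrains the growth of the system. *)
Fixpoint fm (fuel : nat) (vars : seq nat) (cs : seq (bool * seq int)) : bool :=
  has (fun p => p.1 && all (pred1 0) p.2) cs ||
  match fuel, vars with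
  | S fuel, i :: vars =>
    let j := foldr (fun k l => if (fm_cost cs k <= fm_cost cs l)%N then k else l) i vars in
    fm fuel (rem j (i :: vars)) (fm_step j cs)
  | _, _ => false
  end.

Lemma fmP env fuel vars cs : (forall p, p \in cs -> iholds env p) -> ~~ fm fuel vars cs.
Proof.
elim: fuel vars cs => [|fuel IH] vars cs cs0 /=; rewrite negb_or.
  rewrite andbT; apply/hasPn => -[b c] /cs0; rewrite /iholds /=.
  by apply: contraTN => /andP[-> /lin0->]; rewrite ltxx.
apply/andP; split; last first.
  by case: vars => // i vars; apply: IH; apply: fm_stepP.
apply/hasPn => -[b c] /cs0; rewrite /iholds /=.
by apply: contraTN => /andP[-> /lin0->]; rewrite ltxx.
Qed.

Inductive lfact := LEq of lterm & lterm | LLe of lterm & lterm | LLt of lterm & lterm.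

Definition fholds env f : Prop :=
  match f with
  | LEq t u => leval env t = leval env u
  | LLe t u => leval env t <= leval env u
  | LLt t u => leval env t < leval env u
  end.

Definition lsub t u := lnorm (LAdd u (LOpp t)).

Definition feqs := pmap (fun f => if f is LEq t u then Some (lsub t u) else None).
Definition fineqs := pmap (fun f =>
  match f with
  | LEq _ _ => None
  | LLe t u => Some (false, lsub t u)
  | LLt t u => Some (true, lsub t u)
  end).

Definition refutes n fs :=
  fm n (iota 0 n) (elim_eqs (size fs) (feqs fs) (fineqs fs)).

Fixpoint fimpl env fs : Prop :=
  if fs is f :: fs' then fholds env f -> fimpl env fs' else False.

Lemma refutesP env fs : refutes (size env) fs -> fimpl env fs.
Proof.
rewrite /refutes => ref.
suff H : (forall e, e \in feqs fs -> lin env e = 0) ->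
         (forall p, p \in fineqs fs -> iholds env p) -> False.
  elim: fs H {ref} => [|f fs IH] H /=; first exact: H.
  move=> f0; apply: IH => eqs0 ineqs0; apply: H => [e|p].
    case: f f0 => t u /= tu; rewrite ?in_cons; try exact: eqs0.
    by move=> /orP[/eqP->|/eqs0//]; rewrite lin_lnorm /= tu subrr.
  case: f f0 => t u /= tu; rewrite ?in_cons; try exact: ineqs0.
    move=> /orP[/eqP->|/ineqs0//]; rewrite /iholds [snd _]/= lin_lnorm; exact: og_subr_ge0.
  move=> /orP[/eqP->|/ineqs0//]; rewrite /iholds [snd _]/= lin_lnorm; exact: og_subr_gt0.
move=> eqs0 ineqs0; move: ref; apply/negP.
by apply: (@fmP env); apply: elim_eqsP.
Qed.

Lemma og_eqP x y : (x < y -> False) -> (y < x -> False) -> x = y.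
Proof.
by move=> xy yx; apply/le_anti; rewrite !og_leNgt; apply/andP; split; apply/negP.
Qed.

Lemma og_leP x y : (y < x -> False) -> x <= y.
Proof. by rewrite og_leNgt => yx; apply/negP. Qed.

Lemma og_ltP x y : (y <= x -> False) -> x < y.
Proof. by move=> yx; rewrite -[_ < _]negbK -og_leNgt; apply/negP. Qed.

End OrderedGroup.

(** * Reification of linear goals *)

Ltac og_mem x l :=
  lazymatch l with
  | nil => constr:(false)
  | cons x _ => constr:(true)
  | cons _ ?l' => og_mem x l'
  end.

Ltac og_atoms t l :=
  lazymatch t with
  | @GRing.zero _ => l
  | @GRing.add _ ?a ?b => let l := og_atoms a l in og_atoms b l
  | @GRing.opp _ ?a => og_atoms a l
  | @GRing.natmul _ ?a _ => og_atoms a l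
  | _ => lazymatch og_mem t l with true => l | false => constr:(cons t l) end
  end.

Ltac og_index x l :=
  lazymatch l with
  | cons x _ => constr:(O)
  | cons _ ?l' => let i := og_index x l' in constr:(S i)
  end.

Ltac og_term t l :=
  lazymatch t with
  | @GRing.zero _ => constr:(LZero)
  | @GRing.add _ ?a ?b => let a := og_term a l in let b := og_term b l in constr:(LAdd a b)
  | @GRing.opp _ ?a => let a := og_term a l in constr:(LOpp a)
  | @GRing.natmul _ ?a ?n => let a := og_term a l in constr:(LMuln a n)
  | _ => let i := og_index t l in constr:(LVar i)
  end.

Ltac og_goal_atoms g l :=
  lazymatch g with
  | is_true (@Order.le _ _ ?x ?y) -> ?g' =>
      let l := og_atoms x l in let l := og_atoms y l in og_goal_atoms g' l
  | is_true (@Order.lt _ _ ?x ?y) -> ?g' =>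
      let l := og_atoms x l in let l := og_atoms y l in og_goal_atoms g' l
  | @eq _ ?x ?y -> ?g' =>
      let l := og_atoms x l in let l := og_atoms y l in og_goal_atoms g' l
  | False => l
  end.

Ltac og_facts g l :=
  lazymatch g with
  | is_true (@Order.le _ _ ?x ?y) -> ?g' =>
      let x := og_term x l in let y := og_term y l in
      let f := og_facts g' l in constr:(cons (LLe x y) f)
  | is_true (@Order.lt _ _ ?x ?y) -> ?g' =>
      let x := og_term x l in let y := og_term y l in
      let f := og_facts g' l in constr:(cons (LLt x y) f)
  | @eq _ ?x ?y -> ?g' =>
      let x := og_term x l in let y := og_term y l in
      let f := og_facts g' l in constr:(cons (LEq x y) f)
  | False => constr:(@nil lfact)
  end.

(* Fourier-Motzkin elimination on the hypotheses and the negated goal: [porderZmodType]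
   is out of reach of [lra], which needs an ordered ring. *)
Ltac og :=
  lazymatch goal with
  | ord : totally_ordered_group ?L |- _ =>
    lazymatch goal with
    | |- is_true (_ <= _) => apply: (og_leP ord) => ?
    | |- is_true (_ < _) => apply: (og_ltP ord) => ?
    | |- @eq _ _ _ => apply: (og_eqP ord) => ?
    | |- False => idtac
    | |- _ => exfalso
    end;
    repeat match goal with
    | H : is_true (@Order.le _ ?T _ _) |- _ =>
        unify (Order.POrder.sort T) (Num.POrderedZmodule.sort L); revert H
    | H : is_true (@Order.lt _ ?T _ _) |- _ =>
        unify (Order.POrder.sort T) (Num.POrderedZmodule.sort L); revert H
    | H : @eq ?T _ _ |- _ => unify T (Num.POrderedZmodule.sort L); revert H
    end;
    lazymatch goal with
    | |- ?g =>
      let l := og_goal_atoms g (@nil (Num.POrderedZmodule.sort L)) in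
      let f := og_facts g l in
      refine (@refutesP L ord l f _); vm_compute; reflexivity
    end
  end.

(** * Absolute values and positive radii *)

Section OrderedGroupFacts.
Context {L : porderZmodType} (L_ordered : totally_ordered_group L).

Lemma absL_ge0 (x : L) : 0 <= x -> absL x = x.
Proof.
move=> x0; rewrite /absL /Order.max; case: ifP => // xNx.
by have := xNx : (x < - x); og.
Qed.

Lemma absL_le0 (x : L) : x <= 0 -> absL x = - x.
Proof.
move=> x0; rewrite /absL /Order.max; case: ifP => // /negbT.
by rewrite -(og_leNgt L_ordered) => ?; og.
Qed.

(* If no r has this property with r < e, then e is the least positive element
   of L, and r = e works. *)
Lemma half_radius (e : L) : 0 < e ->
  exists2 r, 0 < r & forall x y : L, 0 <= x -> 0 <= y -> x < r -> y < r -> x + y < e.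
Proof.
move=> e0; have [[s [s0 se]]|least] := pselect (exists s : L, 0 < s /\ s < e).
  case: (og_total L_ordered (s + s) e) => le.
    by exists s => // *; og.
  by exists (e - s) => [|*]; og.
have zero (x : L) : 0 <= x -> x < e -> x = 0.
  move=> x0 xe; apply/eqP; apply: contrapT => /negP xn0; apply: least.
  by exists x; rewrite lt_neqAle eq_sym xn0.
by exists e => // x y x0 y0 /(zero x x0)-> /(zero y y0)->; rewrite addr0.
Qed.

(** The element [x0] provides a positive bound when no [t] satisfies [P]. *)
Lemma positive_lower_bound (x0 : L) (T : finType) (P : pred T) (F : T -> L) : 0 < x0 ->
  (forall t, P t -> 0 < F t) ->
  exists2 e, 0 < e & forall t, P t -> e <= F t.
Proof.
move=> x0_gt0 F_gt0.
suff [e e0 le] : exists2 e, 0 < e & forall t, t \in enum T -> P t -> e <= F t.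
  by exists e => // t; apply: le; rewrite mem_enum.
elim: (enum T) => [|t s [e e0 IH]]; first by exists x0.
have [Pt|nPt] := boolP (P t); last first.
  by exists e => // u; rewrite in_cons => /orP[/eqP->|/IH//]; rewrite (negbTE nPt).
case: (og_total L_ordered e (F t)) => eF.
  by exists e => // u; rewrite in_cons => /orP[/eqP->|/IH].
exists (F t) => [|u]; first exact: F_gt0.
by rewrite in_cons => /orP[/eqP->//|/IH uF /uF ?]; og.
Qed.

End OrderedGroupFacts.

(** * Words in two letters *)

(* [(true, e)] is the first generator and [(false, e)] the second one, inverted
   when [e] holds. *)
Definition letter : Type := bool * bool.
Definition letter_inv (s : letter) : letter := (s.1, ~~ s.2).
Definition letter_val {G : groupType} (a b : G) (s : letter) : G :=
  let c := if s.1 then a else b in (if s.2 then c^-1 else c)%g.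

Definition word_val {G : groupType} (a b : G) (w : seq letter) : G :=
  foldr (fun s g => letter_val a b s * g)%g 1%g w.

Definition word_inv (w : seq letter) := rev (map letter_inv w).

Definition no_cancel : rel letter := fun s t => t != letter_inv s.

Lemma letter_val_inv (G : groupType) (a b : G) s :
  letter_val a b (letter_inv s) = (letter_val a b s)^-1%g.
Proof. by case: s => [[] []]; rewrite /letter_val /= ?invgK. Qed.

Lemma word_val_cat (G : groupType) (a b : G) u v :
  word_val a b (u ++ v) = (word_val a b u * word_val a b v)%g.
Proof. by elim: u => [|s u IH] /=; rewrite ?mul1g // IH mulgA. Qed.

Lemma word_val_inv (G : groupType) (a b : G) w :
  word_val a b (word_inv w) = (word_val a b w)^-1%g.
Proof.
rewrite /word_inv; elim: w => [|s w IH] /=; first by rewrite invg1.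
by rewrite rev_cons -cats1 word_val_cat IH /= mulg1 letter_val_inv invgM.
Qed.

Lemma not_sorted_no_cancel w : ~~ sorted no_cancel w ->
  exists u s v, w = u ++ s :: letter_inv s :: v.
Proof.
elim: w => // s [|t w] // IH /=; rewrite negb_and => /orP[|/IH[u [r [v ->]]]].
  by rewrite negbK => /eqP->; exists [::], s, w.
by exists (s :: u), r, v.
Qed.

(** Quantifying over all groups expresses triviality in the free group without constructing that
    group. *)
Definition trivial_word (w : seq letter) : Prop :=
  forall (K : groupType) (k l : K), word_val k l w = 1%g.

Section Generated.
Context {G : groupType} (a b : G).

Let H := generated_by_pair a b.

Lemma generated_by_pair_words : H = range (word_val a b).
Proof.
apply/seteqP; split=> [g|_ [w _ <-]].
  apply; split.
    split; first by apply/mem_set; exists [::].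
    move=> _ _ /set_mem[u _ <-] /set_mem[v _ <-]; apply/mem_set.
    by exists (u ++ word_inv v) => //; rewrite word_val_cat word_val_inv.
  by move=> _ [->|->]; [exists [:: (true, false)] | exists [:: (false, false)]];
    rewrite //= mulg1.
move=> S [S_closed abS]; have [S1 _] := S_closed.
have SM := group_closedM S_closed; have SV := group_closedV S_closed.
elim: w => [|s w IH]; first exact/set_mem.
apply/set_mem/SM; last exact/mem_set.
have Sa : a \in S by apply/mem_set/abS; left.
have Sb : b \in S by apply/mem_set/abS; right.
by case: s => [[] []]; rewrite /letter_val //=; apply: SV.
Qed.

Hypothesis no_relation : forall w, word_val a b w = 1%g -> trivial_word w.

Lemma free_basis2_of_no_relation : free_basis2 H a b.
Proof.
have HE := generated_by_pair_words.
have Hword w : H (word_val a b w) by rewrite HE; exists w.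
have aE : word_val a b [:: (true, false)] = a by rewrite /= mulg1.
have bE : word_val a b [:: (false, false)] = b by rewrite /= mulg1.
have Ha : H a by rewrite -aE.
have Hb : H b by rewrite -bE.
(* [f] evaluates in [K] some word representing [g]. Two such words differ by a relation of [G],
   which also holds in [K], so the choice is immaterial. *)
split=> // K k l; pose f g := word_val k l (xget [::] [set w | word_val a b w = g]).
have fE w : f (word_val a b w) = word_val k l w.
  rewrite /f; case: xgetP => [v _ vw|/(_ w)/(_ erefl)//].
  have := no_relation (w := v ++ word_inv w).
  rewrite !word_val_cat word_val_inv vw mulgV => /(_ erefl)/(_ K k l).
  by rewrite word_val_cat word_val_inv => /eqP; rewrite divg_eq1 => /eqP.
exists f.
  split; last 2 first.
  - by rewrite -[in LHS]aE fE /= mulg1.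
  - by rewrite -[in LHS]bE fE /= mulg1.
  rewrite HE => u v /set_mem[w _ <-] /set_mem[w' _ <-].
  by rewrite -word_val_cat !fE word_val_cat.
move=> f' [f'M f'a f'b] x /set_mem; rewrite {1}HE => -[w _ <-]; rewrite fE.
(* [f'] is multiplicative on [H] only, so its values at 1 and at inverses are derived inside [H]. *)
have f'1 : f' 1%g = 1%g.
  have H1 : 1%g \in H by apply/mem_set; apply: (Hword [::]).
  by apply: (mulgI (f' 1%g)); rewrite -f'M // !mulg1.
have f'V g : H g -> H g^-1%g -> f' g^-1%g = (f' g)^-1%g.
  by move=> Hg Hg'; apply/esym/mulg1_eq; rewrite -f'M ?mem_set // mulgV.
elim: w => [|s w IH] //=.
have Hs : H (letter_val a b s) by have := Hword [:: s]; rewrite /= mulg1.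
rewrite f'M ?mem_set // IH; congr (_ * _)%g.
by case: s Hs => [[] []]; rewrite /letter_val /= => Hs;
  rewrite ?f'V ?f'a ?f'b.
Qed.

End Generated.

Lemma lambda_ball_nbhs (L : porderZmodType) (X : Type) (d : X -> X -> L) x r :
  d x x < r -> 0 < r -> lambda_nbhs d x (lambda_ball d x r).
Proof.
move=> xr r0; exists (lambda_ball d x r); split=> //.
by exists [set (x, r)] => [_ ->//|]; rewrite bigcup_set1.
Qed.

(** * Geometry of Lambda-trees *)

Section LambdaTree.
Context {L : porderZmodType} (L_ordered : totally_ordered_group L).
Context {X : Type} (d : X -> X -> L) (X_tree : lambda_tree d).
Implicit Types (x y z : X) (S T I : set X).

Let X_metric : lambda_metric d. Proof. by case: X_tree. Qed.
Let d_ge0 x y : 0 <= d x y. Proof. by case: X_metric. Qed.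
Let d_eq0 x y : d x y = 0 -> x = y. Proof. by case: X_metric => _ /(_ x y)[]. Qed.
Let d_xx x : d x x = 0. Proof. by case: X_metric => _ /(_ x x)[_ ->]. Qed.
Let d_sym x y : d x y = d y x. Proof. by case: X_metric. Qed.
Let d_tri x y z : d x z <= d x y + d y z. Proof. by case: X_metric. Qed.

(** * Segments and their endpoints *)

Lemma segment_from_to_param x y S : segment_from_to d x y S -> exists p q (i : L -> X),
  [/\ p <= q, forall s t, p <= s -> s <= t -> t <= q -> d (i s) (i t) = t - s,
    i p = x, i q = y & forall z, S z <-> exists2 t, p <= t <= q & i t = z].
Proof.
move=> [p [q [i [pq iso ip iq ->]]]]; exists p, q, i; split=> //.
move=> s t ps st tq; rewrite iso ?ps ?tq ?(le_trans ps st) ?(le_trans st tq) //.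
by rewrite /distL (absL_le0 L_ordered) ?opprB //; og.
Qed.

Lemma segment_param S : segment d S -> exists p q (i : L -> X),
  [/\ p <= q, forall s t, p <= s -> s <= t -> t <= q -> d (i s) (i t) = t - s,
    segment_from_to d (i p) (i q) S & forall z, S z <-> exists2 t, p <= t <= q & i t = z].
Proof.
move=> [x [y xyS]]; have [p [q [i [pq iso ip iq Sz]]]] := segment_from_to_param xyS.
by exists p, q, i; split=> //; rewrite ip iq.
Qed.

Lemma segment_from_to_segment x y S : segment_from_to d x y S -> segment d S.
Proof. by move=> xyS; exists x, y. Qed.

Lemma segment_from_to_ends x y S : segment_from_to d x y S -> S x /\ S y.
Proof.
move=> /segment_from_to_param[p [q [i [pq _ <- <- Sz]]]].
by split; apply/Sz; [exists p | exists q]; rewrite ?lexx ?pq.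
Qed.

Lemma segment_from_to_between x y S z : segment_from_to d x y S -> S z ->
  d x z + d z y = d x y.
Proof.
move=> /segment_from_to_param[p [q [i [pq iso <- <- Sz]]]] /Sz[t /andP[pt tq] <-].
by rewrite !iso //; og.
Qed.

Lemma segment_from_to_dist x y S z w : segment_from_to d x y S -> S z -> S w ->
  d x z <= d x w -> d x z + d z w = d x w.
Proof.
move=> /segment_from_to_param[p [q [i [pq iso <- _ Sz]]]].
move=> /Sz[t /andP[pt tq] <-] /Sz[s /andP[ps sq] <-].
by rewrite (iso p t) // (iso p s) // => ts; rewrite iso //; og.
Qed.

Lemma segment_from_to_point x y S t : segment_from_to d x y S ->
  0 <= t -> t <= d x y -> exists2 z, S z & d x z = t.
Proof.
move=> /segment_from_to_param[p [q [i [pq iso <- <- Sz]]]].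
rewrite iso // => t0 tpq; exists (i (p + t)).
  by apply/Sz; exists (p + t) => //; apply/andP; split; og.
by rewrite iso //; og.
Qed.

Lemma segment_from_to_sym x y S : segment_from_to d x y S -> segment_from_to d y x S.
Proof.
move=> [p [q [i [pq iso ip iq ->]]]]; exists p, q, (fun t => i (p + q - t)); split=> //.
- move=> s t /andP[ps sq] /andP[pt tq]; rewrite iso ?[distL (_ - _) _]/distL.
  + have -> : p + q - s - (p + q - t) = - (s - t) by og.
    rewrite /distL; case: (og_total L_ordered s t) => st.
      by rewrite (absL_ge0 L_ordered) ?(absL_le0 L_ordered) //; og.
    by rewrite (absL_le0 L_ordered) ?(absL_ge0 L_ordered) //; og.
  + by apply/andP; split; og.
  + by apply/andP; split; og.
- by rewrite -iq; congr i; og.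
- by rewrite -ip; congr i; og.
- apply/seteqP; split=> z [t /= /andP[pt tq] <-]; exists (p + q - t) => /=.
  + by apply/andP; split; og.
  + by congr i; og.
  + by apply/andP; split; og.
  + by congr i; og.
Qed.

(** The ends of [I] are at distance [q - p], so [x] and [y] must be these ends. This recovers
    endpoints, which the tree axioms do not name for the segments they produce. *)
Lemma segment_diameter I x y : segment d I -> I x -> I y ->
  (forall u v, I u -> I v -> d u v <= d x y) -> segment_from_to d x y I.
Proof.
move=> /segment_param[p [q [i [pq iso ipq Iz]]]].
move=> /Iz[s /andP[ps sq] <-] /Iz[t /andP[pt tq] <-] diam.
have := diam (i p) (i q); rewrite iso // => {}diam.
have {}diam : q - p <= d (i s) (i t).
  by apply: diam; apply/Iz; [exists p | exists q]; rewrite ?lexx ?pq.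
case: (og_total L_ordered s t) => st.
  rewrite iso // in diam.
  have -> : s = p by og.
  by have -> : t = q by og.
rewrite d_sym iso // in diam.
have -> : s = q by og.
have -> : t = p by og.
exact: segment_from_to_sym.
Qed.

Let segments_meet S T x y z : segment_from_to d x y S -> segment_from_to d x z T ->
  segment d (S `&` T).
Proof.
move=> xyS xzT; case: X_tree => _ _ _ /(_ S T x); apply.
- exact: segment_from_to_segment xyS.
- exact: segment_from_to_segment xzT.
- by exists y; left.
- by exists z; left.
Qed.

Let segments_join S T x y z : segment_from_to d x y S -> segment_from_to d x z T ->
  (forall w, S w -> T w -> w = x) -> segment d (S `|` T).
Proof.
move=> xyS xzT ST; case: X_tree => _ _ /(_ S T x) + _; apply.
- exact: segment_from_to_segment xyS.
- exact: segment_from_to_segment xzT.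
- by exists y; left.
- by exists z; left.
- apply/seteqP; split=> w /=; first by case; apply: ST.
  by move=> ->; split; [case: (segment_from_to_ends xyS) | case: (segment_from_to_ends xzT)].
Qed.

Let sub_diameter x y S u v : segment_from_to d x y S -> S u -> S v -> d u v <= d x y.
Proof.
move=> xyS Su Sv.
have bu := segment_from_to_between xyS Su; have bv := segment_from_to_between xyS Sv.
have := d_ge0 x u; have := d_ge0 x v; have := d_ge0 u y; have := d_ge0 v y.
case: (og_total L_ordered (d x u) (d x v)) => uv.
  by have := segment_from_to_dist xyS Su Sv uv => *; og.
by have := segment_from_to_dist xyS Sv Su uv; rewrite (d_sym v u) => *; og.
Qed.

(** By the second tree axiom the intersection is a segment, and it runs from [x] to [y]. It has a
    point at every distance from [x] up to [d x y], while a segment from [x] has only one at each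
    distance. *)
Lemma segment_unique x y S T :
  segment_from_to d x y S -> segment_from_to d x y T -> S = T.
Proof.
suff sub S' T' : segment_from_to d x y S' -> segment_from_to d x y T' -> S' `<=` T'.
  by move=> xyS xyT; apply/seteqP; split; apply: sub.
move=> xyS xyT z Sz.
have [Sx Sy] := segment_from_to_ends xyS; have [Tx Ty] := segment_from_to_ends xyT.
have xyI : segment_from_to d x y (S' `&` T').
  apply: segment_diameter => //; first exact: segments_meet xyS xyT.
  by move=> u v [Su _] [Sv _]; apply: (sub_diameter xyS).
have [||w [Sw Tw] dw] := @segment_from_to_point x y _ (d x z) xyI => //.
  by rewrite -(segment_from_to_between xyS Sz); have := d_ge0 z y => *; og.
have zw : d z w = 0.
  have : d x z <= d x w by rewrite dw.
  by move=> /(segment_from_to_dist xyS Sz Sw) => *; og.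
by rewrite (d_eq0 zw).
Qed.

(** The segments [z, x] and [z, y] meet only in [z], so the first tree axiom joins them into a
    segment from [x] to [y], which is [S] by uniqueness. *)
Lemma between_segment x y z S : segment_from_to d x y S ->
  d x z + d z y = d x y -> S z.
Proof.
move=> xyS xzy; have [_ geo _ _] := X_tree.
have [Sx zxS] := geo z x; have [Sy zyS] := geo z y.
have [Sxz Sxx] := segment_from_to_ends zxS; have [Syz Syy] := segment_from_to_ends zyS.
suff xyU : segment_from_to d x y (Sx `|` Sy).
  by rewrite (segment_unique xyS xyU); left.
apply: segment_diameter; [|by left|by right|].
  apply: (segments_join zxS zyS) => w Sxw Syw; apply: d_eq0.
  have := segment_from_to_between zxS Sxw; have := segment_from_to_between zyS Syw.
  have := d_tri x w y; rewrite (d_sym w z) (d_sym x z) (d_sym x w) in xzy *.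
  by have := d_ge0 z w => *; og.
have far u : (Sx `|` Sy) u -> (Sx u /\ d z u + d u x = d x z) \/ (Sy u /\ d z u + d u y = d z y).
  move=> [Su|Su]; [left|right]; split=> //; last exact: segment_from_to_between zyS Su.
  by rewrite (d_sym x z); exact: segment_from_to_between zxS Su.
move=> u v /far fu /far fv; rewrite -xzy.
have := d_tri u z v; rewrite (d_sym u z).
have := d_ge0 u x; have := d_ge0 u y; have := d_ge0 v x; have := d_ge0 v y.
have := d_ge0 x z; have := d_ge0 z y.
case: fu fv => [[Su fu]|[Su fu]] [[Sv fv]|[Sv fv]] *; try og.
  have := sub_diameter zxS Su Sv; rewrite (d_sym z x) => *; og.
have := sub_diameter zyS Su Sv => *; og.
Qed.

(** * Betweenness, medians and the four-point condition *)

Lemma between_nested x y u v : d x u + d u y = d x y -> d x v + d v y = d x y ->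
  d x u <= d x v -> d x u + d u v = d x v.
Proof.
have [_ geo _ _] := X_tree; have [S xyS] := geo x y.
move=> /(between_segment xyS) Su /(between_segment xyS) Sv.
exact: (segment_from_to_dist xyS).
Qed.

(** The median is the point of [x, y] and [x, z] farthest from [x]. By maximality [m, y] and [m, z]
    meet only in [m], so their union is a segment. *)
Lemma median_exists x y z : exists m,
  [/\ d x m + d m y = d x y, d x m + d m z = d x z & d y m + d m z = d y z].
Proof.
have [_ geo _ _] := X_tree.
have [S xyS] := geo x y; have [T xzT] := geo x z.
have [Sx Sy] := segment_from_to_ends xyS; have [Tx Tz] := segment_from_to_ends xzT.
have [m [[Sm Tm] mmax]] : exists m, (S `&` T) m /\ forall w, S w -> T w -> d x w <= d x m.
  have [p [q [i [pq iso ipq Iz]]]] := segment_param (segments_meet xyS xzT).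
  have [s /andP[ps sq] isx] : exists2 s, p <= s <= q & i s = x by apply/Iz.
  have [Ip Iq] := segment_from_to_ends ipq.
  have dpx : d x (i p) = s - p by rewrite d_sym -isx iso.
  have dqx : d x (i q) = q - s by rewrite -isx iso.
  have dpq : d (i p) (i q) = q - p by rewrite iso.
  have close w : S w -> T w -> d x w <= q - p.
    by move=> Sw Tw; rewrite -dpq; apply: (sub_diameter ipq).
  (* Both ends lie on [x, y], which forces the nearer one to be [x] and puts the farther one at
     distance [q - p]. *)
  case: (og_total L_ordered (d x (i p)) (d x (i q))) => pq'.
    have := segment_from_to_dist xyS Ip.1 Iq.1 pq' => e.
    by exists (i q); split=> // w Sw Tw; have := close w Sw Tw => *; og.
  have := segment_from_to_dist xyS Iq.1 Ip.1 pq'; rewrite (d_sym (i q)) => e.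
  by exists (i p); split=> // w Sw Tw; have := close w Sw Tw => *; og.
have xmy := segment_from_to_between xyS Sm; have xmz := segment_from_to_between xzT Tm.
exists m; split=> //.
have [Sy' mySy] := geo m y; have [Sz' mzSz] := geo m z.
have meet w : Sy' w -> Sz' w -> w = m.
  move=> /(segment_from_to_between mySy) wy /(segment_from_to_between mzSz) wz.
  have := d_tri x w y; have := d_tri x w z; have := d_tri x m w => *.
  have Sw : S w by apply: (between_segment xyS); og.
  have Tw : T w by apply: (between_segment xzT); og.
  have := mmax w Sw Tw; have := d_ge0 m w => *.
  have xw : d x m + d m w = d x w by og.
  by apply/esym/d_eq0; og.
have [Sym Syy] := segment_from_to_ends mySy; have [Szm Szz] := segment_from_to_ends mzSz.
have [p [q [i [pq iso _ Iz]]]] := segment_param (segments_join mySy mzSz meet).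
have [s /andP[ps sq] ism] : exists2 s, p <= s <= q & i s = m by apply/Iz; left.
have [t /andP[pt tq] ity] : exists2 s, p <= s <= q & i s = y by apply/Iz; left.
have [r /andP[pr rq] irz] : exists2 s, p <= s <= q & i s = z by apply/Iz; right.
have iso' k l : p <= k -> k <= q -> p <= l -> l <= q ->
    (k <= l /\ d (i k) (i l) = l - k) \/ (l <= k /\ d (i k) (i l) = k - l).
  move=> pk kq pl lq; case: (og_total L_ordered k l) => kl; [left|right]; split=> //.
    by rewrite iso.
  by rewrite d_sym iso.
(* On the union one of [m], [y], [z] lies between the other two. If it is [y], then [y] belongs to
   both pieces and equals [m]; likewise for [z]. *)
have ym : d m y + d y z = d m z -> d y m + d m z = d y z.
  move=> myz; have : Sz' y by apply: (between_segment mzSz).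
  by move=> /(meet _ Syy) ->; rewrite d_xx add0r.
have zm : d m z + d z y = d m y -> d y m + d m z = d y z.
  move=> mzy; have : Sy' z by apply: (between_segment mySy).
  by move=> /meet/(_ Szz) ->; rewrite d_xx addr0.
have := iso' s t ps sq pt tq; have := iso' s r ps sq pr rq; have := iso' t r pt tq pr rq.
rewrite ism ity irz (d_sym y m) => e1 e2 e3.
rewrite (d_sym y m) (d_sym z y) in ym zm.
by case: e1 e2 e3 => [[? e1]|[? e1]] [[? e2]|[? e2]] [[? e3]|[? e3]];
  first [og | apply: ym; og | apply: zm; og].
Qed.

(** The points [m] and [n] are where [y] and [w] branch off [x, z]; their order along it decides the
    alternative. *)
Lemma four_point x y z w :
  d x z + d y w <= d x y + d z w \/ d x z + d y w <= d x w + d y z.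
Proof.
have [m [xmy xmz ymz]] := median_exists x y z.
have [n [xnz xnw znw]] := median_exists x z w.
have := d_tri y m w; have := d_tri y n w; have := d_tri m n w; have := d_tri y m n.
rewrite (d_sym y m) (d_sym z n) in ymz znw *.
case: (og_total L_ordered (d x m) (d x n)) => mn.
  have := between_nested xmz xnz mn => *; right; og.
have := between_nested xnz xmz mn; rewrite (d_sym n m) => *; left; og.
Qed.

(* The two largest of the three sums are equal. *)
Lemma four_point_max x y z w :
  [\/ d x y + d z w = d x z + d y w /\ d x w + d y z <= d x y + d z w,
      d x y + d z w = d x w + d y z /\ d x z + d y w <= d x y + d z w |
      d x z + d y w = d x w + d y z /\ d x y + d z w <= d x z + d y w].
Proof.
have := four_point x y z w; have := four_point x z w y; have := four_point x w y z.
rewrite (d_sym w z) (d_sym w y) (d_sym z y).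
by case=> ?; case=> ?; case=> ?; first
  [ by constructor 1; split; og | by constructor 2; split; og | by constructor 3; split; og].
Qed.

(* When f is an isometry and l > 0, this characterizes the points of the axis of
   a hyperbolic f of translation length l. *)
Definition on_axis (f : X -> X) l o := d o (f o) = l /\ d o (f (f o)) = l + l.

(** Positivity rules out both the value 0 given to inversions and the default of [xget]. *)
Lemma translation_length_attained f : 0 < translation_length d f ->
  [/\ ~ inversion f, exists o, d o (f o) = translation_length d f
    & forall y, translation_length d f <= d y (f y)].
Proof.
rewrite /translation_length; case: asboolP => [|noinv]; first by rewrite ltxx.
case: xgetP => [t _ [[y _ <-] lb]|_]; last by rewrite ltxx.
by move=> _; split=> //; [exists y | move=> z; apply: lb; exists z].
Qed.

(** * Axes of isometries *)

Section Isometry.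
Variable f : X -> X.
Hypothesis f_iso : forall x y, d (f x) (f y) = d x y.

(** The median [m] of [x], [f x], [f (f x)] and its image both lie on [f x, f (f x)], at distance
    [l] from each other. The last two equations say that [m] is the point of the axis where the path
    from [f x] arrives. *)
Lemma axis_projection l x : 0 < l -> d x (f (f x)) = d x (f x) + l ->
  exists m, [/\ on_axis f l m, d (f x) (f m) = d (f x) m + l &
                d (f (f x)) m = d (f x) m + l].
Proof.
move=> l0 xffx.
have [m [m1 m2 m3]] := median_exists x (f x) (f (f x)).
have b1 : d (f x) m + d m (f (f x)) = d (f x) (f (f x)) by rewrite f_iso; move: m3; rewrite f_iso.
have b2 : d (f x) (f m) + d (f m) (f (f x)) = d (f x) (f (f x)) by rewrite !f_iso.
rewrite !f_iso in m1 m2 m3 *.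
have lt : d (f x) m <= d (f x) (f m).
  by rewrite f_iso (d_sym (f x) m) in m3 *; og.
have := between_nested b1 b2 lt; rewrite f_iso => b3.
exists m; rewrite (d_sym (f (f x)) m) (d_sym (f x) m) in m3 b3 *.
have mfm : d m (f m) = l by og.
rewrite f_iso; split; last 2 first; [by og|by og|].
split=> //; have := d_tri m (f m) (f (f m)); rewrite f_iso mfm => *.
(* The known distance from [f x] to [f (f (f x))] bounds [d m (f (f m))] from below by [l + l]. *)
have := d_tri (f x) m (f (f (f x))); have := d_tri m (f (f m)) (f (f (f x))).
rewrite !f_iso (d_sym (f x) m) => *; og.
Qed.

(** Since [f o] is the midpoint of [o, f (f o)], at least one direction of the axis at [f o] leads
    straight away from [y]. *)
Lemma axis_convex l o y : on_axis f l o ->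
  d y (f o) + l <= d y o \/ d y (f o) + l <= d y (f (f o)).
Proof.
move=> [ofo offo]; have := four_point y o (f o) (f (f o)); rewrite !f_iso offo ofo.
by case=> ?; [left|right]; og.
Qed.

Lemma axis_step l o y : on_axis f l o ->
  d y (f o) <= d y o + l /\ d y o <= d y (f o) + l.
Proof.
move=> [ofo _]; have := d_tri y o (f o); have := d_tri y (f o) o.
by rewrite (d_sym (f o) o) ofo; split; og.
Qed.

(** Take [o] of minimal displacement. The median of [o], [f o], [f (f o)] is displaced by less than
    [l] unless it is [f o], which puts [o] on the axis, or [o], which makes [f] an inversion. *)
Lemma translation_length_axis :
  0 < translation_length d f -> exists o, on_axis f (translation_length d f) o.
Proof.
set l := translation_length d f => l0.
have [noinv [o ofo] min] := translation_length_attained l0; rewrite -/l in ofo min.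
exists o; split=> //.
have [m [m1 m2 m3]] := median_exists o (f o) (f (f o)).
have b1 : d (f o) m + d m (f (f o)) = d (f o) (f (f o)) by rewrite f_iso; move: m3; rewrite f_iso.
have b2 : d (f o) (f m) + d (f m) (f (f o)) = d (f o) (f (f o)) by rewrite !f_iso.
have c1 := between_nested b1 b2.
have c2 := between_nested b2 b1.
have := min m; have := d_ge0 (f o) m; have := d_ge0 o m.
rewrite !f_iso (d_sym (f m) m) (d_sym (f o) m) in m1 m2 m3 c1 c2 * => g1 g2 g3.
case: (og_total L_ordered (d m (f o)) (d o m)) => [/c1|/c2] c; first by og.
have offo : d o (f (f o)) = 0 by og.
case: noinv; split; last by exists o; rewrite -(d_eq0 offo).
by move=> y fy; have := min y; rewrite fy d_xx => ?; og.
Qed.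

Variables (l : L) (o : X).
Hypotheses (l_gt0 : 0 < l) (o_axis : on_axis f l o).

Let ofo : d o (f o) = l. Proof. by case: o_axis. Qed.
Let offo : d o (f (f o)) = l + l. Proof. by case: o_axis. Qed.

Let o1_axis : on_axis f l (f o).
Proof. by case: o_axis => *; split; rewrite !f_iso. Qed.

Lemma displacement_ge y : l <= d y (f y).
Proof.
have := d_tri y (f y) (f o); have := d_tri y (f y) (f (f o)).
have := d_tri (f y) y (f o); rewrite !f_iso (d_sym (f y) y).
by case: (axis_convex y o_axis) => *; og.
Qed.

(** Seen from a point [z] of the orbit of [o], consecutive images of [y] change their distance by
    [l]. The four-point condition for [y], [f y], [f (f y)], [z] then gives the equation. *)
Lemma displacement_square y : d y (f (f y)) = d y (f y) + l.
Proof.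
have key z u0 u1 u2 : d y z = u2 -> d (f y) z = u1 -> d (f (f y)) z = u0 ->
    (u1 + l = u2 /\ u0 < u2) \/ (u1 + l = u0 /\ u2 < u0) ->
    d y (f (f y)) = d y (f y) + l.
  move=> <- <- <-.
  have := four_point_max y (f y) (f (f y)) z; rewrite !f_iso.
  by case=> -[? ?] [[? ?]|[? ?]]; og.
have c0 := axis_convex y o_axis.
have c1 := axis_convex y o1_axis.
have [s0 s0'] := axis_step y o_axis.
have [s1 s1'] := axis_step y o1_axis.
(* The choice [z = f (f o)] fails when [y] is equally far from [o] and [f (f o)]; one step further
   along the axis the tie is broken. *)
have [e|ne] := eqVneq (d y o) (d y (f (f o))).
  apply: (key (f (f (f o))) (d y (f o)) (d y (f (f o))) (d y (f (f (f o))))); rewrite ?f_iso //.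
  have := d_tri y (f (f o)) (f (f (f o))); rewrite !f_iso ofo => s2.
  by left; case: c0 c1 => ? [] ?; split; og.
apply: (key (f (f o)) (d y o) (d y (f o)) (d y (f (f o)))); rewrite ?f_iso //.
case: (og_total L_ordered (d y o) (d y (f (f o)))) => le.
  have lt : d y o < d y (f (f o)) by rewrite lt_neqAle ne.
  by left; case: c0 => ?; split; og.
have lt : d y (f (f o)) < d y o by rewrite lt_neqAle eq_sym ne.
by right; case: c0 => ?; split; og.
Qed.

(** If [q, o] missed [p], then [o] would be farther by [l] from both neighbours of [p] on the axis
    than from [p]. For [o] on the axis this forces [o = p]. *)
Lemma axis_gate p q : on_axis f l p -> d q (f p) = d q p + l -> d (f q) p = d q p + l ->
  d q o = d q p + d p o.
Proof.
move=> [pfp pffp] qfp fqp.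
have := d_tri q p o => le; apply/le_anti/andP; split=> //; apply: (og_leP L_ordered) => lt.
have e1 : d (f p) o = d p o + l.
  have := four_point_max p q (f p) o.
  rewrite (d_sym p q) pfp qfp => -[] [? ?]; og.
have e2 : d p (f o) = d p o + l.
  have := four_point_max (f p) (f q) p (f o).
  rewrite !f_iso (d_sym (f p) p) (d_sym p q) pfp fqp => -[] [? ?]; og.
have := four_point_max o p (f p) (f o).
rewrite !f_iso (d_sym o (f p)) (d_sym o p) e1 e2 pfp ofo.
have := d_tri q o p; rewrite (d_sym o p).
by have := d_ge0 p o => ? ? [] [? ?]; og.
Qed.

Lemma axis_no_inversion : ~ inversion f.
Proof.
case=> _ [y ffy]; have := displacement_square y; rewrite ffy d_xx.
by have := d_ge0 y (f y) => *; og.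
Qed.

Lemma axis_translation_length : translation_length d f = l.
Proof.
rewrite /translation_length; case: asboolP => [/axis_no_inversion//|_].
case: xgetP => [t _ [[y _ <-] lb]|/(_ l)]; last first.
  case; split; first by exists o.
  by move=> _ [y _ <-]; apply: displacement_ge.
apply/le_anti/andP; split; first by apply: lb; exists o.
exact: displacement_ge.
Qed.

End Isometry.

(** * Ping-pong *)

Section Action.
Context {G : groupType} (act : G -> X -> X) (act_isom : isometric_action d act).
Implicit Types (g h : G).

Lemma act1 x : act 1%g x = x. Proof. by case: act_isom. Qed.
Lemma actM g h x : act (g * h)%g x = act g (act h x). Proof. by case: act_isom. Qed.
Lemma act_dist g x y : d (act g x) (act g y) = d x y.
Proof. by case: act_isom => _ _ /(_ g)[]. Qed.
Lemma actK g x : act g^-1%g (act g x) = x. Proof. by rewrite -actM mulVg act1. Qed.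
Lemma actVK g x : act g (act g^-1%g x) = x. Proof. by rewrite -actM mulgV act1. Qed.
Lemma act_distV g x y : d x (act g^-1%g y) = d (act g x) y.
Proof. by rewrite -(act_dist g) actVK. Qed.
Lemma act_distVl g x y : d (act g^-1%g x) y = d x (act g y).
Proof. by rewrite -(act_dist g) actVK. Qed.

(* If the axes of g and h share a piece of length at least the minimum of lg and
   lh around p, then g and h move the point z where [p, g^-1 p] and [p, h^-1 p]
   part to points at distance |lg - lh| from each other. *)
Lemma axis_overlap g h (lg lh m : L) p :
  d p (act g p) = lg -> d p (act h p) = lh ->
  lg - lh < m -> lh - lg < m -> (forall z, m <= d (act g z) (act h z)) ->
  lg + lg < d (act g p) (act h p) + d (act g^-1%g p) (act h^-1%g p) /\
  lh + lh < d (act g p) (act h p) + d (act g^-1%g p) (act h^-1%g p).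
Proof.
move=> pgp php lt1 lt2 min; set P := act g^-1%g p; set Q := act h^-1%g p.
have [z [z1 z2 z3]] := median_exists p P Q.
have dP : d p P = lg by rewrite act_distV d_sym.
have dQ : d p Q = lh by rewrite act_distV d_sym.
have gzp : d (act g z) p = d z P by rewrite /P act_distV.
have hzp : d (act h z) p = d z Q by rewrite /Q act_distV.
have := min z; have := four_point p (act g z) (act g p) (act h p).
have := four_point p (act g z) (act h p) (act h z).
rewrite (d_sym p (act g z)) (d_sym p (act h z)) gzp hzp !act_dist.
rewrite (d_sym z p) php pgp.
rewrite dP dQ (d_sym P z) in z1 z2 z3.
by case=> ?; case=> ? ?; split; og.
Qed.

(* With (x|y) the Gromov product at p, the inequality amounts to
   (rp|sp) + (s^-1 p|tp) < d(p, sp): on each edge of the orbit path of a reduced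
   word, the backtracking at both ends leaves a nondegenerate piece. *)
Definition star_at a b p : Prop :=
  let D s := d p (act (letter_val a b s) p) in
  let E s t := d (act (letter_val a b s) p) (act (letter_val a b t) p) in
  forall r s t, r != s -> t != letter_inv s -> D r + D t < E r s + E (letter_inv s) t.

Lemma axis_at_inverse a (la : L) p : on_axis (act a) la p ->
  [/\ d p (act a p) = la, d p (act a^-1%g p) = la & d (act a p) (act a^-1%g p) = la + la].
Proof.
move=> [pap paap]; split=> //; first by rewrite act_distV d_sym.
by rewrite act_distV d_sym.
Qed.

(** At a common point of the axes, Gromov products can be positive only along the overlap, in its
    two directions; [axis_overlap] bounds the sum of these two products. *)
Lemma axes_meet_star a b (la lb m : L) p :
  0 < la -> 0 < lb -> on_axis (act a) la p -> on_axis (act b) lb p ->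
  la - lb < m -> lb - la < m ->
  (forall z, m <= d (act a z) (act b z)) ->
  (forall z, m <= d (act a z) (act b^-1%g z)) -> star_at a b p.
Proof.
move=> la0 lb0 /axis_at_inverse[pa pA aA] /axis_at_inverse[pb pB bB] lt1 lt2 min min'.
have [o1 o2] := axis_overlap pa pb lt1 lt2 min.
have [o3 o4] := axis_overlap pa pB lt1 lt2 min'.
move: o3 o4; have -> : act b^-1^-1%g p = act b p by rewrite invgK.
(* The path from [p] to [z] cannot start towards both opposite neighbours [x] and [y]. *)
have opp x y z lx lz : d p x = lx -> d p y = lx -> d p z = lz -> d x y = lx + lx ->
    0 < lx -> d x z = lx + lz \/ d y z = lx + lz.
  move=> px py pz xy lx0; have := four_point_max p x y z.
  have := d_tri x p z; have := d_tri y p z.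
  rewrite (d_sym x p) (d_sym y p) px py pz xy => ? ? [] [? ?];
    first [by left; og | by right; og | exfalso; og].
have tri x y lx ly : d p x = lx -> d p y = ly ->
    [/\ d x y <= lx + ly, lx <= ly + d x y & ly <= lx + d x y].
  move=> px py; have := d_tri x p y; have := d_tri p x y; have := d_tri p y x.
  by rewrite (d_sym x p) (d_sym y x) px py => *; split; og.
have := opp _ _ _ _ _ pa pA pb aA la0; have := opp _ _ _ _ _ pa pA pB aA la0.
have := opp _ _ _ _ _ pb pB pa bB lb0; have := opp _ _ _ _ _ pb pB pA bB lb0.
rewrite !(d_sym (act b p)) !(d_sym (act b^-1%g p)).
have [t1 t2 t3] := tri _ _ _ _ pa pb; have [t4 t5 t6] := tri _ _ _ _ pa pB.
have [t7 t8 t9] := tri _ _ _ _ pA pb; have [t10 t11 t12] := tri _ _ _ _ pA pB.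
move=> {opp tri} c1 c2 c3 c4 o3 o4.
(* The two cases are the two relative orientations of the axes along their overlap. *)
have {c1 c2 c3 c4} c :
    (d (act a p) (act b^-1%g p) = la + lb /\ d (act a^-1%g p) (act b p) = la + lb) \/
    (d (act a p) (act b p) = la + lb /\ d (act a^-1%g p) (act b^-1%g p) = la + lb).
  case: c1 => c1; case: c2 => c2; case: c3 => c3; case: c4 => c4;
    first [by left; split; og | by right; split; og].
rewrite /star_at => -[[] []] [[] []] [[] []] //= _ _;
  rewrite /letter_val /= ?(d_sym (act b p) (act a p)) ?(d_sym (act b p) (act a^-1%g p))
    ?(d_sym (act b^-1%g p) (act a p)) ?(d_sym (act b^-1%g p) (act a^-1%g p))
    ?(d_sym (act b^-1%g p) (act b p)) ?(d_sym (act a^-1%g p) (act a p))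
    ?pa ?pA ?aA ?pb ?pB ?bB;
  by case: c => -[? ?]; og.
Qed.

(** The path from [p] to [b p] runs through [q] and [b q]. Only [b p] and [b^-1 p] share a piece,
    namely [p, q], and twice its length is less than the edge length [2 d(p, q) + lb]. *)
Lemma axes_gate_star a b (la lb : L) p q :
  0 < la -> 0 < lb -> p <> q ->
  on_axis (act a) la p -> on_axis (act b) lb q ->
  d q (act a p) = d q p + la -> d q (act a^-1%g p) = d q p + la ->
  d p (act b q) = d p q + lb -> d p (act b^-1%g q) = d p q + lb ->
  star_at a b p.
Proof.
move=> la0 lb0 pq pa_axis /[dup] qb_axis /axis_at_inverse[qb qB bB] qa qA pb pB.
have [pa pA aA] := axis_at_inverse pa_axis.
have dpq : 0 < d p q.
  by rewrite lt_neqAle d_ge0 andbT eq_sym; apply/eqP => /d_eq0.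
have bpq g : d (act g p) (act g q) = d p q by rewrite act_dist.
have bpqb : d (act b p) q = d p q + lb by rewrite -act_distV.
have bpqB : d (act b^-1%g p) q = d p q + lb by rewrite act_distVl.
have Db : d p (act b p) = d p q + d p q + lb.
  have := four_point_max p q (act b q) (act b p).
  rewrite (d_sym q (act b p)) (d_sym (act b q)) bpq pb qb bpqb.
  by case=> -[? ?]; og.
have DB : d p (act b^-1%g p) = d p q + d p q + lb.
  by rewrite act_distV d_sym.
have EbB : d (act b p) (act b^-1%g p) = d p q + d p q + lb + lb.
  rewrite act_distV d_sym (displacement_square (act_dist b) lb0 qb_axis).
  by rewrite Db.
have far x y : d p x = la -> d q x = d q p + la -> d p y = d p q + d p q + lb ->
    d y q = d p q + lb -> d x y = d p q + d p q + la + lb.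
  move=> px qx py yq; have := four_point_max p q x y.
  rewrite (d_sym q y) (d_sym q p) in qx yq *.
  by rewrite px qx py yq => -[] [? ?]; og.
have Eab := far _ _ pa qa Db bpqb; have EaB := far _ _ pa qa DB bpqB.
have EAb := far _ _ pA qA Db bpqb; have EAB := far _ _ pA qA DB bpqB.
rewrite /star_at => -[[] []] [[] []] [[] []] //= _ _;
  rewrite /letter_val /= ?(d_sym (act b p) (act a p)) ?(d_sym (act b p) (act a^-1%g p))
    ?(d_sym (act b^-1%g p) (act a p)) ?(d_sym (act b^-1%g p) (act a^-1%g p))
    ?(d_sym (act b^-1%g p) (act b p)) ?(d_sym (act a^-1%g p) (act a p))
    ?pa ?pA ?aA ?Db ?DB ?EbB ?Eab ?EaB ?EAb ?EAB;
  clear -L_ordered la0 lb0 dpq; og.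
Qed.

Lemma ping_pong_base_point a b :
  ping_pong_pair (translation_length_function d act) a b -> exists p, star_at a b p.
Proof.
rewrite /ping_pong_pair /translation_length_function.
set la := translation_length d (act a); set lb := translation_length d (act b).
set lab := translation_length _ _; set laB := translation_length _ _ => -[la0 lb0].
set m := Order.min lab laB => lt_m.
have absx (x : L) : x <= absL x /\ - x <= absL x.
  by case: (og_total L_ordered 0 x) => x0;
    [rewrite (absL_ge0 L_ordered) | rewrite (absL_le0 L_ordered)] => //; split; og.
have [m1 m2] := absx (la - lb).
have lt1 : la - lb < m by og.
have lt2 : lb - la < m by og.
have [mab maB] : m <= lab /\ m <= laB.
  rewrite /m /Order.min; case: ifP => [lt|/negbT]; last first.
    by rewrite -(og_leNgt L_ordered) => le; split.
  by split=> //; apply: ltW.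
have lab0 : 0 < lab by og.
have laB0 : 0 < laB by og.
(* Here [a * b^-1] moves [b z] to [a z], and below [a * b] moves [b^-1 z] to [a z]. *)
have min z : m <= d (act a z) (act b z).
  apply: (le_trans maB); have [_ _ /(_ (act b z))] := translation_length_attained laB0.
  by rewrite actM actK d_sym.
have min' z : m <= d (act a z) (act b^-1%g z).
  apply: (le_trans mab); have [_ _ /(_ (act b^-1%g z))] := translation_length_attained lab0.
  by rewrite actM actVK d_sym.
have [o oa] := translation_length_axis (act_dist a) la0.
have [o' ob] := translation_length_axis (act_dist b) lb0.
have proj c l z w : 0 < l -> on_axis (act c) l w ->
    exists v, [/\ on_axis (act c) l v, d z (act c v) = d z v + l & d z (act c^-1%g v) = d z v + l].
  move=> l0 cw.
  have := displacement_square (act_dist c) l0 cw (act c^-1%g z).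
  move=> /(axis_projection (act_dist c) l0)[v []].
  by rewrite actVK -act_distV; exists v.
(* Project [o], on the axis of [a], to [q] on the axis of [b], and then [q] back to [p]. *)
have [q [qb qb1 qb2]] := proj b lb o o' lb0 ob.
have [p [pa qa1 qa2]] := proj a la q o la0 oa.
have gate : d q o = d q p + d p o.
  by apply: (axis_gate (act_dist a) la0 oa pa) => //; rewrite -act_distV.
exists p; have [pq|pq] := pselect (p = q).
  by rewrite -pq in qb; apply: (axes_meet_star la0 lb0 pa qb lt1 lt2).
have dpq : 0 < d p q by rewrite lt_neqAle d_ge0 andbT eq_sym; apply/eqP => /d_eq0.
(* [q] is the projection of [o]; as [p] lies on [q, o] and differs from [q], it is the projection of
   [p] as well. *)
have := four_point_max q p o (act b q); have := four_point_max q p o (act b^-1%g q).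
have [qb3 qb4 _] := axis_at_inverse qb.
rewrite gate qb3 qb4 qb1 qb2 (d_sym o q) gate (d_sym q p).
move=> c1 c2; apply: (axes_gate_star la0 lb0 pq pa qb) => //.
  by case: c2 => -[? ?]; og.
by case: c1 => -[? ?]; og.
Qed.

(** * Distances along reduced words *)

Section Chain.
Implicit Types (r s t u : letter) (v w : seq letter).

(** The bound is on [l + l] because [e] need not be divisible by 2 in [L]. *)
Definition hyperbolic_above (e : L) g : Prop :=
  exists m l, [/\ 0 < l, e <= l + l & on_axis (act g) l m].

Lemma hyperbolic_above_conj e g h :
  hyperbolic_above e g -> hyperbolic_above e (h * g * h^-1)%g.
Proof.
move=> [m [l [l0 el [m1 m2]]]]; exists (act h m), l; split=> //; split.
  by rewrite !actM actK act_dist.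
by rewrite !actM !actK act_dist.
Qed.

Variables (a b : G) (p : X) (e : L).

Let pt s := act (letter_val a b s) p.
Let D s := d p (pt s).
Let E s t := d (pt s) (pt t).
Let F w := d p (act (word_val a b w) p).

Hypothesis e_gt0 : 0 < e.
Hypothesis star : forall r s t, r != s -> t != letter_inv s ->
  D r + D t + e <= E r s + E (letter_inv s) t.

Let D_inv s : D (letter_inv s) = D s.
Proof. by rewrite /D /pt letter_val_inv act_distV d_sym. Qed.

Let F1 s : F [:: s] = D s.
Proof. by rewrite /F /= mulg1. Qed.

Let F_cons s w : F (s :: w) = d (pt (letter_inv s)) (act (word_val a b w) p).
Proof. by rewrite /pt letter_val_inv act_distVl -actM. Qed.

(** In terms of Gromov products at [p], the far end of the path may be replaced by its first vertex
    [t p]. By induction the backtracking at [t p] is governed by the next letter alone, and [star]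
    keeps it disjoint from the backtracking at [p]. *)
Lemma chain_gate r t w : path no_cancel t w -> r != t ->
  d (pt r) (act (word_val a b (t :: w)) p) + D t = F (t :: w) + E r t.
Proof.
elim: w t r => [|u w IH] t r /=.
  by move=> _ rt; rewrite F1 mulg1 addrC.
move=> /andP[ut pw] rt.
have tu : letter_inv t != u by rewrite eq_sym.
have := IH u (letter_inv t) pw tu; rewrite -F_cons.
have := star rt ut.
have := four_point_max p (pt r) (pt t) (act (word_val a b (t :: u :: w)) p).
rewrite -/(F _) -/(E _ _) -/(D _).
have -> : d (pt t) (act (word_val a b (t :: u :: w)) p) = F (u :: w).
  by rewrite /pt /= actM act_dist.
rewrite -/(D r) -/(D t) /=.
by case=> -[? ?] ? ?; og.
Qed.

(** The increment of [F] caused by a new first letter thus depends only on that letter and the next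
    one. *)
Lemma chain_step s t w : path no_cancel s (t :: w) ->
  F (s :: t :: w) + D t = F (t :: w) + E (letter_inv s) t.
Proof.
move=> /= /andP[st pw]; rewrite F_cons; apply: chain_gate => //.
by rewrite eq_sym.
Qed.

(* Along a reduced word F itself need not increase with each letter, since a
   backtrack may be longer than half of the next edge, but T does. *)
Let T w := F w + F (behead w) - D (head (true, true) w).

(** By [chain_step] twice, one more letter raises [T] by exactly the difference of the two sides of
    the unsharpened [star] inequality, hence by at least [e]. A single gain of [e] is recorded,
    however long [v] is. *)
Lemma chain_growth v s t w : sorted no_cancel (v ++ s :: t :: w) ->
  T (s :: t :: w) + (if v is [::] then 0 else e) <= T (v ++ s :: t :: w).
Proof.
have step r u u' w' : path no_cancel r (u :: u' :: w') ->
    T (u :: u' :: w') + e <= T (r :: u :: u' :: w').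
  move=> ruw; have /= /and3P[ru uu pw] := ruw.
  have := chain_step ruw; have := @chain_step u u' w'; rewrite /= uu => /(_ pw).
  have ru' : letter_inv r != u by rewrite eq_sym.
  by have := star ru' uu; rewrite D_inv /T /= => *; og.
elim: v => [|r v IH]; first by rewrite addr0.
case: v IH => [|u v] IH srt; first exact: step.
have := IH (path_sorted srt).
case: v {IH} srt => [|u' v] srt /=.
  by have := step r u s (t :: w) srt => /= *; og.
by have := step r u u' (v ++ s :: t :: w) srt => /= *; og.
Qed.

Lemma chain_periodic v t w w' : sorted no_cancel (v ++ t :: w) -> sorted no_cancel (v ++ t :: w') ->
  F (v ++ t :: w) + F (t :: w') = F (v ++ t :: w') + F (t :: w).
Proof.
elim: v => [|s v IH]; first by rewrite addrC.
case: v IH => [|u v] IH sw sw'.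
  by have := @chain_step s t w sw; have := @chain_step s t w' sw'; rewrite /= => *; og.
have := IH (path_sorted sw) (path_sorted sw').
have := @chain_step s u (v ++ t :: w) sw; have := @chain_step s u (v ++ t :: w') sw'.
by rewrite /= => *; og.
Qed.

Lemma cycle_hyperbolic s w : cycle no_cancel (s :: w) ->
  hyperbolic_above e (word_val a b (s :: w)).
Proof.
move=> cyc; set W := s :: w.
have [srt2 srt3] : sorted no_cancel (W ++ W) /\ sorted no_cancel (W ++ W ++ W).
  by move: cyc; rewrite /= rcons_path !cat_path /= cat_path /= => /andP[-> ->].
have srt1 : sorted no_cancel W by move: srt2 => /= ; rewrite cat_path => /andP[].
have per1 := @chain_periodic W s (w ++ W) w srt3 srt2.
have [per2 growth] : F (w ++ W ++ W) + F W = F (w ++ W) + F (W ++ W) /\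
    T (W ++ W) + e <= T (W ++ W ++ W).
  split; first exact: chain_periodic (path_sorted srt3) (path_sorted srt2).
  by case: w @W {cyc srt1 srt2 per1} srt3 => [|t w] W srt3; apply: chain_growth srt3.
have TE v : T (s :: v) = F (s :: v) + F v - D s by [].
rewrite !cat_cons !TE -!cat_cons -/W in growth per1.
(* Both [F] terms of [T] grow from [W ++ W] to [W ++ W ++ W] by the same increment, which is the
   translation length sought. *)
have {}growth : e <= (F (W ++ W) - F W) + (F (W ++ W) - F W) by og.
have C_gt0 : 0 < F (W ++ W) - F W by og.
have [|m [axis _ _]] := axis_projection
  (act_dist (word_val a b W)) (x := p) C_gt0.
  by rewrite -actM -word_val_cat -!/(F _); og.
by exists m, (F (W ++ W) - F W).
Qed.

(* A word either contains a cancelling pair, or is a conjugate of a shorter one,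
   or is cyclically reduced. *)
Lemma trivial_or_hyperbolic w :
  trivial_word w \/ hyperbolic_above e (word_val a b w).
Proof.
have [n] := ubnP (size w); elim: n w => // n IH w; rewrite ltnS => wn.
have [srt|/not_sorted_no_cancel[u [s [v wE]]]] := boolP (sorted no_cancel w); last first.
  have cancel (K : groupType) (k l : K) : word_val k l w = word_val k l (u ++ v).
    by rewrite wE !word_val_cat /= letter_val_inv mulVKg.
  have [|triv|hyp] := IH (u ++ v).
  - by apply: leq_trans wn; rewrite wE !size_cat /= ltn_add2l.
  - by left=> K k l; rewrite cancel.
  - by right; rewrite cancel.
case: w srt wn => [|s w] srt wn; first by left.
have [cyc|] := boolP (cycle no_cancel (s :: w)); first by right; apply: cycle_hyperbolic.
case/lastP: w srt wn => [|w t] srt wn.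
  (* A one-letter word is a cycle, since no letter is its own inverse. *)
  by case: s {srt wn} => [] [] [].
rewrite /= rcons_path last_rcons (srt : path _ _ _) /= negbK => /eqP s_inv.
have conj (K : groupType) (k l : K) : word_val k l (s :: rcons w t) =
    (letter_val k l s * word_val k l w * (letter_val k l s)^-1)%g.
  rewrite /= -cats1 word_val_cat /= mulg1 mulgA; congr (_ * _)%g.
  by rewrite s_inv letter_val_inv invgK.
have [|triv|hyp] := IH w.
- by apply: leq_trans wn; rewrite /= size_rcons ltnS leqnSn.
- by left=> K k l; rewrite conj triv mulg1 mulgV.
- by right; rewrite -[(_ * _)%g]/(word_val a b (s :: rcons w t)) conj; apply: hyperbolic_above_conj.
Qed.

End Chain.

(** * Consequences for ping-pong pairs *)

Section PingPong.
Variables (a b : G).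
Hypothesis ab_ping_pong : ping_pong_pair (translation_length_function d act) a b.

Let H := generated_by_pair a b.

(** There are finitely many triples of letters, so the strict inequalities of [star_at] have a
    common positive gap. *)
Lemma ping_pong_words : exists2 e : L, 0 < e &
  forall w, trivial_word w \/ hyperbolic_above e (word_val a b w).
Proof.
have [p star] := ping_pong_base_point ab_ping_pong.
have [a0 _ _] := ab_ping_pong.
pose D s := d p (act (letter_val a b s) p).
pose E s t := d (act (letter_val a b s) p) (act (letter_val a b t) p).
pose P (rst : letter * letter * letter) := let: (r, s, t) := rst in
  (r != s) && (t != letter_inv s).
pose gap (rst : letter * letter * letter) := let: (r, s, t) := rst in
  E r s + E (letter_inv s) t - (D r + D t).
have [|e e0 le] := @positive_lower_bound L L_ordered _ _ P gap a0.
  move=> [[r s] t] /andP[rs ts]; have := star r s t rs ts.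
  by rewrite -/(D _) -/(D _) -/(E _ _) -/(E _ _) /gap => *; og.
exists e => // w; apply: (trivial_or_hyperbolic (p := p)) => //.
move=> r s t rs ts; have := le (r, s, t); rewrite /P rs ts => /(_ isT).
by rewrite /gap /E /D => *; og.
Qed.

Lemma hyperbolic_above1 e : ~ hyperbolic_above e 1%g.
Proof.
move=> [m [l [l0 _ [+ _]]]]; rewrite act1 d_xx => l_eq.
by rewrite -l_eq ltxx in l0.
Qed.

Lemma ping_pong_no_relation w : word_val a b w = 1%g -> trivial_word w.
Proof.
have [e _ /(_ w)[//|hyp] w1] := ping_pong_words.
by rewrite w1 in hyp; case: (hyperbolic_above1 hyp).
Qed.

Lemma ping_pong_hyperbolic : exists2 e : L, 0 < e &
  forall g, H g -> g != 1%g -> hyperbolic_above e g.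
Proof.
have [e e0 dich] := ping_pong_words; exists e => // g.
rewrite /H generated_by_pair_words => -[w _ <-] w1.
by case: (dich w) => // /(_ G a b) w1'; rewrite w1' eqxx in w1.
Qed.

Lemma ping_pong_displacement : exists2 e : L, 0 < e &
  forall g, H g -> g != 1%g -> [/\ ~ inversion (act g),
    e <= translation_length d (act g) & forall x, e <= d x (act g x)].
Proof.
have [e e0 hyp] := ping_pong_hyperbolic; have [r r0 half] := half_radius L_ordered e0.
exists r => // g Hg g1; have [m [l [l0 el axis]]] := hyp g Hg g1.
(* If [l < r], the choice of [r] would give [l + l < e]. *)
have rl : r <= l.
  apply: (og_leP L_ordered) => lr; have := half l l (ltW l0) (ltW l0) lr lr => *; og.
split.
- exact: (axis_no_inversion (act_dist g) l0 axis).
- by rewrite (axis_translation_length (act_dist g) l0 axis).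
- move=> x; apply: (le_trans rl).
  exact: (displacement_ge (act_dist g) l0 axis).
Qed.

Lemma ping_pong_free : free_of_rank_two H.
Proof. by exists a, b; apply: free_basis2_of_no_relation; apply: ping_pong_no_relation. Qed.

Lemma ping_pong_acts_freely : acts_freely act H.
Proof.
have [e e0 disp] := ping_pong_displacement.
move=> x g Hg gx; apply/eqP; apply: contrapT => /negP /(disp g Hg)[_ _ /(_ x)].
by rewrite gx d_xx => *; og.
Qed.

Lemma ping_pong_no_inversion : acts_without_inversions act H.
Proof.
have [e e0 disp] := ping_pong_displacement.
move=> g Hg; have [->|/(disp g Hg)[]//] := eqVneq g 1%g.
by case=> no_fix [x _]; apply: (no_fix x); rewrite act1.
Qed.

Lemma ping_pong_properly_discontinuous : acts_properly_discontinuously d act H.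
Proof.
have [e e0 disp] := ping_pong_displacement; have [r r0 half] := half_radius L_ordered e0.
move=> x; exists (lambda_ball d x r); first by apply: lambda_ball_nbhs; rewrite ?d_xx.
move=> g Hg [_ [[y xy <-] xgy]]; apply/eqP; apply: contrapT => /negP /(disp g Hg)[_ _ /(_ x)].
have := half _ _ (d_ge0 x y) (d_ge0 x (act g y)) xy xgy.
have := d_tri x (act g y) (act g x); rewrite act_dist (d_sym y x) => *; og.
Qed.

End PingPong.

End Action.
End LambdaTree.

(** Nontrivial elements have length at least [e], so continuity at 1 isolates 1 in the subgroup;
    left translation isolates every other element. *)
Lemma ping_pong_discrete (L : porderZmodType) (L_ordered : totally_ordered_group L)
    (X : Type) (d : X -> X -> L) (X_tree : lambda_tree d)
    (G : topologicalGroupType) (act : G -> X -> X) (a b : G) :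
  isometric_action d act ->
  ping_pong_pair (translation_length_function d act) a b ->
  continuous_at_one (translation_length_function d act) ->
  discrete_subspace (generated_by_pair a b).
Proof.
move=> act_isom pp cont; set ell := translation_length_function d act in cont.
have [e e0 disp] := ping_pong_displacement L_ordered X_tree act_isom pp.
have ell1 : ell 1%g = 0.
  (* At 1 the inversion value, the minimum and the default of [xget] are all 0. *)
  rewrite /ell /translation_length_function /translation_length; case: asboolP => // _.
  case: xgetP => // _ _ [[x _ <-] _]; rewrite (act1 act_isom).
  by case: X_tree => -[_ /(_ x x)[_ ->]].
pose U : set L := lambda_ball distL 0 e.
have : lambda_nbhs distL (ell 1%g) U.
  by rewrite ell1; apply: lambda_ball_nbhs; rewrite // /distL subrr (absL_ge0 L_ordered).
move=> /cont; rewrite nbhsE => -[W [W_open W1] WU] A AH.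
have H_isolated g : generated_by_pair a b g -> W g -> g = 1%g.
  move=> Hg /WU; rewrite /U /lambda_ball /= /distL sub0r => lt.
  apply/eqP; apply: contrapT => /negP /(disp g Hg)[_ le _].
  have {}le : e <= ell g := le.
  have Ng0 : - ell g <= 0 by og.
  by rewrite (absL_le0 L_ordered) // opprK in lt; og.
(* The union of the translates [h W], each of which meets the subgroup in [h] alone. *)
exists (\bigcup_(h in A) [set g | W (h^-1 * g)%g]).
  apply: bigcup_open => h _; apply: open_comp => // g _.
  apply: (@continuous2_cvg _ _ _ _ _ _ (fun=> h^-1%g) id (fun x y => (x * y)%g)).
  - exact: (mulg_continuous (h^-1%g, g)).
  - exact: cvg_cst.
  - exact: cvg_id.
apply/seteqP; split=> g.
  move=> Ag; split; first exact: AH.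
  by exists g => //=; rewrite mulVg.
move=> [Hg [h Ah /=]] /H_isolated Hhg.
suff -> : g = h by [].
apply: (mulgI h^-1%g); rewrite mulVg; apply: Hhg.
move: Hg (AH h Ah); rewrite generated_by_pair_words => -[u _ <-] [v _ <-].
by exists (word_inv v ++ u) => //; rewrite word_val_cat word_val_inv.
Qed.

Theorem corollary4p1 (L : porderZmodType)
    (L_ordered : totally_ordered_group L)
    (L_nontrivial : exists x : L, x != 0)
    (X : Type) (d : X -> X -> L) (X_tree : lambda_tree d) :
  (forall (G : groupType) (act : G -> X -> X) (a b : G),
     isometric_action d act ->
     ping_pong_pair (translation_length_function d act) a b ->
     [/\ free_of_rank_two (generated_by_pair a b),
         acts_freely act (generated_by_pair a b),
         acts_without_inversions act (generated_by_pair a b)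
       & acts_properly_discontinuously d act (generated_by_pair a b)]) /\
  (forall (G : topologicalGroupType) (act : G -> X -> X) (a b : G),
     isometric_action d act ->
     ping_pong_pair (translation_length_function d act) a b ->
     continuous_at_one (translation_length_function d act) ->
     discrete_subspace (generated_by_pair a b)).
Proof.
split=> G act a b act_isom pp; last exact: ping_pong_discrete.
split.
- exact: (ping_pong_free L_ordered X_tree act_isom pp).
- exact: (ping_pong_acts_freely L_ordered X_tree act_isom pp).
- exact: (ping_pong_no_inversion L_ordered X_tree act_isom pp).
- exact: (ping_pong_properly_discontinuous L_ordered X_tree act_isom pp).
Qed.
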